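(* Let $(f,M)$ be a marked complete affine $2$-torus, let $A\in\mathsf{SL}(2,\mathbb{Z})$, and let $\phi_A\colon T^2\to T^2$ be the diffeomorphism of $T^2=\mathbb{R}^2/\mathbb{Z}^2$ induced by the linear map $A\colon\mathbb{R}^2\to\mathbb{R}^2$. Then $$\mathsf{p}(f\circ\phi_A,M)=A^{t}\big(\mathsf{p}(f,M)\big),$$ where $A^t$ is the transpose of $A$ and period classes are regarded as column vectors.
   Context: Affine structures. $\mathbb{A}^2$ is real affine $2$-space with an orientation and $\mathsf{Aff}(2)$ is its group of orientation-preserving affine automorphisms. An affine structure on an oriented smooth surface is a maximal atlas of (orientation-compatible) charts into $\mathbb{A}^2$ whose transition maps are locally restrictions of elements of $\mathsf{Aff}(2)$; equivalently it is given by a flat torsionfree affine connection $\nabla$. It is complete if the surface is affinely diffeomorphic to a quotient of $\mathbb{A}^2$ by a discrete group of affine transformations acting properly (and freely) on $\mathbb{A}^2$. A complete affine $2$-torus is Euclidean if it is affinely diffeomorphic to a quotient of $\mathbb{A}^2$ by a lattice of translations, and non-Riemannian otherwise. A marked complete affine $2$-torus is a pair $(f,M)$ with $M$ an oriented complete affine $2$-torus and $f\colon T^2\to M$ an orientation-preserving diffeomorphism, where $T^2=\mathbb{R}^2/\mathbb{Z}^2$ with basepoint the image of $0$ and $\pi_1(T^2)\cong\mathbb{Z}^2$ has standard basis $\alpha_1=(1,0)$, $\alpha_2=(0,1)$. Period class. A tensor field on $M$ is parallel if its coefficients in affine coordinates are constant, and polynomial if its coefficients in affine coordinates are polynomial.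 For an oriented non-Riemannian complete affine $2$-torus $M$ let $\omega_M$ be the parallel area form with $\int_M\omega_M=1$. There is a unique parallel vector field $\zeta_M$ such that $\zeta_M=\nabla_{\xi_M}\xi_M$ and $\omega_M(\zeta_M,\xi_M)=1$ for some polynomial vector field $\xi_M$. Put $\eta_M=\iota_{\zeta_M}\omega_M$ (interior product). The period class of $(f,M)$ is $$\mathsf{p}(f,M)=\Big(\int_{\alpha_1}f^*\eta_M,\ \int_{\alpha_2}f^*\eta_M\Big)\in\mathbb{R}^2$$ if $M$ is non-Riemannian, and $\mathsf{p}(f,M)=(0,0)$ if $M$ is Euclidean. *)

(* Defs.v *)
From HB Require Import structures.
From mathcomp Require Import all_boot all_order all_algebra.
From mathcomp Require Import all_classical all_reals all_analysis.
Set Implicit Arguments.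
Unset Strict Implicit.
Unset Printing Implicit Defensive.
Import Order.TTheory GRing.Theory Num.Theory.
Import numFieldNormedType.Exports.
Local Open Scope classical_set_scope.
Local Open Scope quotient_scope.
Local Open Scope ring_scope.

Notation plane R := 'cV[R]_2.

Fixpoint Ck (R : realType) (V W : normedModType R) (n : nat) (U : set V)
    (F : V -> W) : Prop :=
  match n with
  | 0%N => forall x, U x -> {for x, continuous F}
  | m.+1 => (forall x, U x -> differentiable F x) /\
            (forall v, Ck m U (fun x => 'd F x v))
  end.

(* C^infinity on an open set U. *)
Definition smooth_on (R : realType) (V W : normedModType R) (U : set V)
    (F : V -> W) : Prop :=
  forall n, Ck n U F.

(* Columns are the partial derivatives: the differential acts on column
   vectors. *)
Definition jac (R : realType) (F : plane R -> plane R) (a : plane R) :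
    'M[R]_2 :=
  \matrix_(i, j) ('d F a (delta_mx j 0)) i 0.

(* An affine map x |-> L x + b is encoded by the pair (L, b). *)
Notation aff R := ('M[R]_2 * plane R)%type.

Definition aff_act (R : realType) (g : aff R) (x : plane R) : plane R :=
  g.1 *m x + g.2.

Definition aff_mul (R : realType) (g h : aff R) : aff R :=
  (g.1 *m h.1, g.1 *m h.2 + g.2).

Definition aff_inv (R : realType) (g : aff R) : aff R :=
  (invmx g.1, - (invmx g.1 *m g.2)).

(* Subgroups of the orientation-preserving affine group. *)
Record affGroup (R : realType) := AffGroup {
  aff_elts :> aff R -> Prop;
  aff_det : forall g, aff_elts g -> 0 < \det g.1;
  aff_one : aff_elts (1%:M, 0);
  aff_mulP : forall g h, aff_elts g -> aff_elts h -> aff_elts (aff_mul g h);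
  aff_invP : forall g, aff_elts g -> aff_elts (aff_inv g) }.

Definition aff_discrete (R : realType) (G : affGroup R) : Prop :=
  forall g, G g -> \forall h \near g, G h -> h = g.

(* Proper action of a discrete group. *)
Definition aff_proper (R : realType) (G : affGroup R) : Prop :=
  forall K : set (plane R), compact K ->
    finite_set [set g | G g /\ (aff_act g @` K) `&` K !=set0].

Definition aff_free (R : realType) (G : affGroup R) : Prop :=
  forall g x, G g -> aff_act g x = x -> g = (1%:M, 0).

Section Quotient.
Variables (R : realType) (G : affGroup R).

Definition orbit_rel (x y : plane R) : bool :=
  `[< exists2 g, G g & y = aff_act g x >].

Lemma orbit_refl : reflexive orbit_rel.
Proof.
move=> x; apply/asboolP; exists (1%:M, 0); first exact: aff_one.
by rewrite /aff_act/= mul1mx addr0.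
Qed.

Lemma orbit_sym : symmetric orbit_rel.
Proof.
suff H x y : orbit_rel x y -> orbit_rel y x.
  by move=> x y; apply/idP/idP; exact: H.
move=> /asboolP[g Gg ->]; apply/asboolP; exists (aff_inv g).
  exact: aff_invP.
have gu : g.1 \in unitmx by rewrite unitmxE unitfE gt_eqF// (aff_det Gg).
by rewrite /aff_act/= mulmxDr mulmxA mulVmx// mul1mx addrK.
Qed.

Lemma orbit_trans : transitive orbit_rel.
Proof.
move=> y x z /asboolP[g Gg ->] /asboolP[h Gh ->]; apply/asboolP.
exists (aff_mul h g); first exact: aff_mulP.
by rewrite /aff_act/= mulmxDr mulmxA addrA.
Qed.

Canonical orbit_equiv := EquivRel orbit_rel orbit_refl orbit_sym orbit_trans.

Definition quot : Type := quotient_topology {eq_quot orbit_equiv}.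
HB.instance Definition _ := Quotient.copy quot {eq_quot orbit_equiv}.
HB.instance Definition _ := EqQuotient.copy quot {eq_quot orbit_equiv}.
HB.instance Definition _ :=
  Topological.copy quot (quotient_topology {eq_quot orbit_equiv}).

End Quotient.

Record chart (R : realType) (M : topologicalType) := Chart {
  dom : set M;
  img : set (plane R);
  coord : M -> plane R;
  param : plane R -> M;
  dom_open : open dom;
  img_open : open img;
  coord_img : forall x, dom x -> img (coord x);
  param_dom : forall a, img a -> dom (param a);
  coordK : forall x, dom x -> param (coord x) = x;
  paramK : forall a, img a -> coord (param a) = a;
  coord_cont : forall x, dom x -> {for x, continuous coord};
  param_cont : forall a, img a -> {for a, continuous param} }.

Record atlasSpace (R : realType) := AtlasSpace {
  space :> topologicalType;
  atlas : set (chart R space) }.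

(* Near x, the function v is u followed by an element of Aff(2). *)
Definition aff_near (R : realType) (T : topologicalType)
    (u v : T -> plane R) (g : aff R) (x : T) : Prop :=
  0 < \det g.1 /\ \forall y \near x, v y = aff_act g (u y).

Definition compatible (R : realType) (M : topologicalType) (c c' : chart R M) :
    Prop :=
  forall x, dom c x -> dom c' x ->
    exists g, aff_near (coord c) (coord c') g x.

(* An oriented affine surface: the maximal affine atlas determines the smooth
   structure and the orientation. *)
Definition affine_surface (R : realType) (M : atlasSpace R) : Prop :=
  [/\ hausdorff_space M,
      @second_countable M,
      forall x : M, exists2 c, atlas c & dom c x,
      forall c c' : chart R M, atlas c -> atlas c' -> compatible c c' &
      forall c : chart R M, (forall c', atlas c' -> compatible c c') ->
        atlas c].

(* Affine maps are orientation preserving.  For "affinely diffeomorphic to a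
   quotient" this is no restriction: compose with a reflection of the plane and
   conjugate the group (resp. the lattice) by it. *)
Definition affine_map (R : realType) (M N : atlasSpace R) (f : M -> N) : Prop :=
  continuous f /\
  forall (c : chart R M) (c' : chart R N) x, atlas c -> atlas c' ->
    dom c x -> dom c' (f x) ->
    exists g, aff_near (coord c) (coord c' \o f) g x.

Definition affinely_diffeomorphic (R : realType) (M N : atlasSpace R) : Prop :=
  exists (f : M -> N) (h : N -> M),
    [/\ cancel f h, cancel h f, affine_map f & affine_map h].

Definition quot_surface (R : realType) (G : affGroup R) : atlasSpace R :=
  @AtlasSpace R (quot G)
    [set c | forall a : plane R, dom c (\pi_(quot G) a) ->
       exists g, aff_near id (coord c \o \pi_(quot G)) g a].

Definition complete_surface (R : realType) (M : atlasSpace R) : Prop :=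
  exists G : affGroup R,
    [/\ aff_discrete G, aff_proper G, aff_free G &
        affinely_diffeomorphic M (quot_surface G)].

(* The translations by B Z^2. *)
Section Lattice.
Variables (R : realType) (B : 'M[R]_2).

Definition lattice_elts : set (aff R) :=
  [set g | g.1 = 1%:M /\ exists z : 'cV[int]_2, g.2 = B *m map_mx intr z].

Lemma lattice_det g : lattice_elts g -> 0 < \det g.1.
Proof. by case=> -> _; rewrite det1. Qed.

Lemma lattice_one : lattice_elts (1%:M, 0).
Proof. by split=> //; exists 0; rewrite map_mx0 mulmx0. Qed.

Lemma lattice_mul g h :
  lattice_elts g -> lattice_elts h -> lattice_elts (aff_mul g h).
Proof.
case: g h => [g1 g2] [h1 h2] [/= -> [z ->]] [/= -> [w ->]].
split; rewrite /= ?mulmx1//; exists (w + z).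
by rewrite map_mxD mulmxDr mul1mx.
Qed.

Lemma lattice_inv g : lattice_elts g -> lattice_elts (aff_inv g).
Proof.
case: g => [g1 g2] [/= -> [z ->]]; split; rewrite /= ?invmx1//; exists (- z).
by rewrite map_mxN mulmxN mul1mx.
Qed.

Definition lattice_group : affGroup R :=
  AffGroup lattice_det lattice_one lattice_mul lattice_inv.

End Lattice.

Definition euclidean (R : realType) (M : atlasSpace R) : Prop :=
  exists2 B : 'M[R]_2, B \in unitmx &
    affinely_diffeomorphic M (quot_surface (lattice_group B)).

Definition T2 (R : realType) : atlasSpace R :=
  quot_surface (lattice_group (1%:M : 'M[R]_2)).

Definition torus_proj (R : realType) (a : plane R) : T2 R :=
  \pi_(quot (lattice_group (1%:M : 'M[R]_2))) a.

Definition torus_map (R : realType) (A : 'M[int]_2) (x : T2 R) : T2 R :=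
  torus_proj (map_mx intr A *m repr (x : quot _)).

Lemma torus_mapE (R : realType) (A : 'M[int]_2) (a : plane R) :
  torus_map A (torus_proj a) = torus_proj (map_mx intr A *m a).
Proof.
rewrite /torus_map /torus_proj; set Q := quot _.
have piP (x y : plane R) :
    orbit_rel (lattice_group (1%:M : 'M[R]_2)) x y <-> \pi_Q x = \pi_Q y.
  by rewrite -(@eqquotE _ _ Q); split => /eqP.
apply/piP; have /piP := reprK (\pi_Q a).
move=> /asboolP[[g1 g2] [/= -> [z ->]] ab]; apply/asboolP.
exists (1%:M, 1%:M *m map_mx intr (A *m z)).
  by split=> //; exists (A *m z).
by rewrite {1}ab /aff_act/= !mul1mx mulmxDr map_mxM.
Qed.

Definition smooth_map (R : realType) (M N : atlasSpace R) (f : M -> N) : Prop :=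
  continuous f /\
  forall (c : chart R M) (c' : chart R N), atlas c -> atlas c' ->
    smooth_on [set a | img c a /\ dom c' (f (param c a))]
      (coord c' \o f \o param c).

Definition orientation_preserving (R : realType) (M N : atlasSpace R)
    (f : M -> N) : Prop :=
  forall (c : chart R M) (c' : chart R N) x, atlas c -> atlas c' ->
    dom c x -> dom c' (f x) ->
    0 < \det (jac (coord c' \o f \o param c) (coord c x)).

Definition op_diffeo (R : realType) (M N : atlasSpace R) (f : M -> N) : Prop :=
  [/\ smooth_map f, orientation_preserving f &
      exists h : N -> M, [/\ cancel f h, cancel h f & smooth_map h]].

Definition marked_complete_affine_torus (R : realType) (M : atlasSpace R)
    (f : T2 R -> M) : Prop :=
  [/\ affine_surface M, complete_surface M & op_diffeo f].

(* A tensor field is given by its coefficients in each chart of the atlas; only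
   the values on the domain of the chart are meaningful.  Vector fields have
   column, 1-forms row coefficients; the coefficient of a 2-form is the factor
   of dx /\ dy. *)
Definition vfield (R : realType) (M : atlasSpace R) : Type :=
  chart R M -> M -> plane R.
Definition form1 (R : realType) (M : atlasSpace R) : Type :=
  chart R M -> M -> 'rV[R]_2.
Definition form2 (R : realType) (M : atlasSpace R) : Type :=
  chart R M -> M -> R.

Section Tensors.
Variables (R : realType) (M : atlasSpace R).

Definition tensorial_vfield (X : vfield M) : Prop :=
  forall (c c' : chart R M) x g, atlas c -> atlas c' -> dom c x -> dom c' x ->
    aff_near (coord c) (coord c') g x -> X c' x = g.1 *m X c x.

Definition tensorial_form2 (w : form2 M) : Prop :=
  forall (c c' : chart R M) x g, atlas c -> atlas c' -> dom c x -> dom c' x ->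
    aff_near (coord c) (coord c') g x -> w c x = w c' x * \det g.1.

Definition parallel (V : Type) (X : chart R M -> M -> V) : Prop :=
  forall (c : chart R M) x, atlas c -> dom c x ->
    \forall y \near x, X c y = X c x.

Definition polynomial (X : vfield M) : Prop :=
  forall (c : chart R M) x, atlas c -> dom c x ->
    exists n (a : nat -> nat -> plane R), \forall y \near x,
      X c y = \sum_(i < n) \sum_(j < n)
        (coord c y 0 0 ^+ i * coord c y 1 0 ^+ j) *: a i j.

(* nabla_X Y; the flat connection is the coordinatewise derivative in affine
   coordinates. *)
Definition covd (X Y : vfield M) : vfield M :=
  fun c x => 'D_(X c x) (Y c \o param c) (coord c x).

Definition form2_eval (w : form2 M) (X Y : vfield M) (c : chart R M) (x : M) :
    R :=
  w c x * \det (row_mx (X c x) (Y c x)).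

Definition interior (X : vfield M) (w : form2 M) : form1 M :=
  fun c x => \row_j form2_eval w X (fun _ _ => delta_mx j 0) c x.

Definition plane_of (p : R * R) : plane R :=
  \col_i (if i == 0 then p.1 else p.2).

Definition partition_of_unity (n : nat) (c : 'I_n -> chart R M)
    (rho : 'I_n -> M -> R) : Prop :=
  [/\ forall k x, 0 <= rho k x,
      forall x, \sum_(k < n) rho k x = 1,
      forall k, closure [set x | rho k x != 0] `<=` dom (c k) &
      forall k (c' : chart R M), atlas c' ->
        smooth_on (img c') (rho k \o param c' : plane R -> R^o)].

(* The integral of a 2-form over a compact M, through a finite smooth partition
   of unity subordinate to (positively oriented) affine charts. *)
Definition form2_integral (w : form2 M) : R :=
  get [set v : R | exists n (c : 'I_n -> chart R M) (rho : 'I_n -> M -> R),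
    [/\ forall k, atlas (c k), partition_of_unity c rho &
        v = \sum_(k < n)
          \int[(lebesgue_measure \x lebesgue_measure)%E]_(p in
              [set p : R * R | img (c k) (plane_of p)])
            (let x := param (c k) (plane_of p) in rho k x * w (c k) x)]].

Definition unit_area_form (w : form2 M) : Prop :=
  [/\ tensorial_form2 w, parallel w,
      forall (c : chart R M) x, atlas c -> dom c x -> w c x != 0 &
      form2_integral w = 1].

(* omega_M, and zeta_M below, are the unique fields satisfying the specification
   (zero if there is none). *)
Definition omega_M : form2 M := xget (fun _ _ => 0) [set w | unit_area_form w].

Definition zeta_spec (Z : vfield M) : Prop :=
  [/\ tensorial_vfield Z, parallel Z &
      exists X : vfield M, [/\ tensorial_vfield X, polynomial X &
        forall (c : chart R M) x, atlas c -> dom c x ->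
          Z c x = covd X X c x /\ form2_eval omega_M Z X c x = 1]].

Definition zeta_M : vfield M := xget (fun _ _ => 0) [set Z | zeta_spec Z].

Definition eta_M : form1 M := interior zeta_M omega_M.

(* The integral over [0, 1] of th (g' t); the integrand does not depend on the
   chart around g t in which it is computed. *)
Definition path_integral (th : form1 M) (g : R -> M) : R :=
  \int[lebesgue_measure]_(t in `[0, 1])
    get [set v : R | exists c : chart R M, [/\ atlas c, dom c (g t) &
           v = (th c (g t) *m derive1 (coord c \o g) t) 0 0]].

End Tensors.

Definition pullback (R : realType) (M N : atlasSpace R) (f : M -> N)
    (th : form1 N) : form1 M :=
  fun c x => get [set r : 'rV[R]_2 | exists c' : chart R N,
    [/\ atlas c', dom c' (f x) &
        r = th c' (f x) *m jac (coord c' \o f \o param c) (coord c x)]].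

(* The loop representing the i-th standard generator of pi_1(T2). *)
Definition alpha (R : realType) (i : 'I_2) (t : R) : T2 R :=
  torus_proj (t *: delta_mx i 0).

Definition period (R : realType) (M : atlasSpace R) (f : T2 R -> M) :
    'cV[R]_2 :=
  if `[< euclidean M >] then 0
  else \col_i path_integral (pullback f (@eta_M R M)) (alpha i).

(* Main.v *)
From HB Require Import structures.
Require Import Defs.
From mathcomp Require Import all_boot all_order all_algebra.
From mathcomp Require Import all_classical all_reals all_analysis.
From mathcomp Require Import ring lra.
Import Order.TTheory GRing.Theory Num.Theory.
Import numFieldNormedType.Exports.
Set Implicit Arguments.
Unset Strict Implicit.
Unset Printing Implicit Defensive.
Local Open Scope classical_set_scope.
Local Open Scope quotient_scope.
Local Open Scope ring_scope.
Local Notation coord := Defs.coord.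

(** If M is Euclidean both sides vanish.  Otherwise let eta be the form whose
periods are taken.  In every affine chart it has locally constant coefficients,
so it is locally the differential of an affine function of the coordinates: it is
closed.  Pulled back to the plane along the composite phi of the projection
onto the torus with f, it becomes a closed form invariant under integer
translations.

The plane is simply connected, so this form has a primitive F
([plane_primitive]).  For an integer vector z, the function
a |-> F (a + z) - F a is locally constant, hence equal to some constant p z
([primitive_translate]), and p is additive.  The i-th loop composed with the map
of the torus induced by A lifts to the segment from 0 to A e_i; the fundamental
theorem of calculus gives the period p (A e_i) along it
([path_integral_pullback]).  As p is additive,
p (A e_i) = \sum_j A_ji p (e_j), which is the i-th entry of A^T applied to the
vector of the periods p (e_j) of f.

The existence of F is purely topological, so it is shown for an arbitrary family
of local potentials determined up to constants: primitives on two closed sets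
with connected intersection can be glued ([has_primitive_glue]), and an
induction over intervals, used first for the width and then for the height,
extends them from small rectangles to all of them. *)

(** * Connected sets and induction over intervals *)

(** A level set of h is the trace on K of an open set (where h keeps its value
nearby) and of a closed one (off which h avoids this value nearby), so by
connectedness it is all of K. *)
Lemma locally_constant_connected (T : topologicalType) (V : Type) (K : set T)
    (h : T -> V) :
  connected K -> (forall a, K a -> \forall b \near a, K b -> h b = h a) ->
  forall a b, K a -> K b -> h a = h b.
Proof.
move=> cK hloc a b Ka Kb.
suff E : [set x | K x /\ h x = h a] = K by move: Kb; rewrite -{1}E => -[].
apply: cK; first by exists a.
- exists (interior [set x | K x -> h x = h a]); first exact: open_interior.
  apply/seteqP; split=> x /= [Kx].
    by move=> xa; split=> //; have := hloc x Kx; rewrite xa.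
  by move=> /interior_subset /(_ Kx).
- exists (~` interior [set x | K x -> h x <> h a]).
    exact/open_closedC/open_interior.
  apply/seteqP; split=> x /= [Kx].
    by move=> xa; split=> // /interior_subset /(_ Kx).
  move=> nx; split=> //; apply: contrapT => xa; apply: nx.
  by apply: filterS (hloc x Kx) => y + Ky; move=> ->.
Qed.

(** A relatively open and closed part of K pulls back along every segment of K
to such a part of the unit interval, which is connected. *)
Lemma convex_connected (R : realType) (E : normedModType R) (K : set E) :
  (forall a b t, K a -> K b -> 0 <= t <= 1 -> K (a + t *: (b - a))) ->
  connected K.
Proof.
move=> cK B [b Bb] [C oC BC] [D cD BD].
have BK : B `<=` K by rewrite BC; exact: subIsetl.
apply/seteqP; split=> // c Kc.
pose g (t : R) : E := b + t *: (c - b).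
have cg : continuous g.
  move=> t; apply: cvgD; first exact: cvg_cst.
  exact: scalel_continuous.
have Kg t : t \in `[0, 1] -> K (g t).
  by rewrite in_itv/= => t01; apply: cK => //; exact: BK.
have hB : `[0, 1]%classic `&` (g @^-1` B) = `[0, 1]%classic.
  apply: (@segment_connected R 0 1).
  - exists 0; rewrite /= in_itv/= lexx ler01; split=> //.
    by rewrite /g scale0r addr0.
  - exists (g @^-1` C); first by move/continuousP: cg; exact.
    apply/seteqP; split=> t /= [t01]; rewrite BC /=; first by case.
    by move=> Ct; do 2?split => //; exact: Kg.
  - exists (g @^-1` D).
      by apply: (preimage_closed _ cD) => t _; exact: cg.
    apply/seteqP; split=> t /= [t01]; rewrite BD /=; first by case.
    by move=> Ct; do 2?split => //; exact: Kg.
have : `[0, 1]%classic (1 : R) by rewrite /= in_itv/= ler01 lexx.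
by rewrite -hB => -[_]; rewrite /g /= scale1r addrC subrK.
Qed.

(** Cousin's form of compactness: a property of intervals that is stable under
concatenation and holds for the small intervals around each point holds for all
intervals.  The supremum of the t for which Q a t holds is passed by means of
the small intervals around it, unless it is the right end. *)
Lemma interval_induction (R : realType) (Q : R -> R -> Prop) :
  (forall s m t, s <= m <= t -> Q s m -> Q m t -> Q s t) ->
  (forall x, exists2 d, 0 < d &
     forall s t, x - d < s -> s <= x <= t -> t < x + d -> Q s t) ->
  forall s t, s <= t -> Q s t.
Proof.
move=> Qcat Qloc a b ab.
pose S := [set t | a <= t <= b /\ Q a t].
have Sa : S a.
  split; first by rewrite lexx.
  by have [d d0] := Qloc a; apply; rewrite ?lexx ?ltrBlDr ?ltrDl.
have supS : has_sup S.
  by split; [exists a|exists b => t [/andP[]]].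
set c := sup S.
have ac : a <= c by apply: ub_le_sup => //; exact: supS.2.
have cb : c <= b by apply: ge_sup => [|t [/andP[]]//]; exists a.
have [d d0 Qd] := Qloc c.
have [t [/andP[at_ tb] Qt] ct] := sup_adherent d0 supS.
have tc : t <= c by apply: ub_le_sup; [exact: supS.2|split; rewrite ?at_].
pose e := Num.min b (c + d / 2).
have ce : c <= e by rewrite le_min cb lerDl divr_ge0// ltW.
have ed : e < c + d.
  by rewrite gt_min; apply/orP; right; lra.
have Qe : Q a e.
  apply: Qcat Qt _; first by rewrite at_ (le_trans tc).
  by apply: Qd => //; rewrite tc.
have : e <= c.
  apply: ub_le_sup; first exact: supS.2.
  by split=> //; rewrite (le_trans ac ce) ge_min lexx.
rewrite ge_min => /orP[bc|]; last by rewrite gerDl leNgt divr_gt0.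
suff <- : e = b by [].
by apply/eqP; rewrite eq_le ge_min lexx/= (le_trans bc).
Qed.

(** * Primitives of a family of local potentials *)

Section Potentials.
Variables (T : topologicalType) (V : zmodType).
(* P a U is read: near a, the function U is a potential of a fixed closed form,
   of which nothing else is retained. *)
Variable P : T -> (T -> V) -> Prop.

(** The variations of G are those of the potentials, tested only inside K: on
the boundary of K the condition is one-sided, as gluing along edges requires. *)
Definition primitive_on (K : set T) (G : T -> V) : Prop :=
  forall a U, K a -> P a U -> \forall b \near a, K b -> G b - G a = U b - U a.

Definition has_primitive (K : set T) : Prop := exists G, primitive_on K G.

Lemma primitive_on_sub (K L : set T) (G : T -> V) :
  K `<=` L -> primitive_on L G -> primitive_on K G.
Proof.
move=> KL GP a U Ka PU.
by apply: filterS (GP a U (KL _ Ka) PU) => b Gb Kb; apply: Gb; exact: KL.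
Qed.

Lemma has_primitive_sub (K L : set T) :
  K `<=` L -> has_primitive L -> has_primitive K.
Proof.
by move=> KL [G GP]; exists G; exact: primitive_on_sub GP.
Qed.

Hypothesis P_ex : forall a, exists U, P a U.

(** The difference of two primitives is locally constant. *)
Lemma primitive_unique (K : set T) (G H : T -> V) : connected K ->
  primitive_on K G -> primitive_on K H ->
  forall a b, K a -> K b -> G b - G a = H b - H a.
Proof.
move=> cK GP HP a b Ka Kb.
suff E : H b - G b = H a - G a.
  by rewrite -[H b](subrK (G b)) E addrAC (addrAC (H a)) subrr add0r addrC.
apply: (@locally_constant_connected _ _ K (fun x => H x - G x)) => //.
move=> x Kx; have [U PU] := P_ex x.
near=> y => Ky.
have EG : G y - G x = U y - U x by move: Ky; near: y; exact: GP.
have EH : H y - H x = U y - U x by move: Ky; near: y; exact: HP.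
by rewrite -[H y](subrK (H x)) EH -EG addrAC (addrAC (G y)) subrr add0r addrC.
Unshelve. all: by end_near. Qed.

(** On the connected intersection the two primitives differ by a constant k, and
correcting one of them by k makes them agree there.  Closedness ensures that
only the sets containing a point matter near this point. *)
Lemma has_primitive_glue (K L : set T) : closed K -> closed L ->
  connected (K `&` L) -> has_primitive K -> has_primitive L ->
  has_primitive (K `|` L).
Proof.
move=> clK clL cKL [G GP] [H HP].
have [k kP] : exists k, forall x, (K `&` L) x -> G x = H x + k.
  have [->|/set0P[x0 [Kx0 Lx0]]] := eqVneq (K `&` L) set0; first by exists 0.
  exists (G x0 - H x0) => x KLx.
  apply/eqP; rewrite addrCA addrC -subr_eq; apply/eqP.
  have KLx0 : (K `&` L) x0 by split.
  apply: (primitive_unique cKL _ _ KLx0 KLx).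
    by apply: primitive_on_sub GP; exact: subIsetl.
  by apply: primitive_on_sub HP; exact: subIsetr.
exists (fun x => if `[< K x >] then G x else H x + k).
have onK x : K x -> (if `[< K x >] then G x else H x + k) = G x.
  by move=> Kx; case: asboolP.
have onL x : L x -> (if `[< K x >] then G x else H x + k) = H x + k.
  by move=> Lx; case: asboolP => // Kx; rewrite kP.
have nearJ (J : set T) (F : T -> V) a U : closed J ->
    primitive_on J F -> P a U ->
    \forall b \near a, J b -> J a /\ F b - F a = U b - U a.
  move=> clJ FP PU; have [Ja|nJa] := pselect (J a).
    by apply: filterS (FP a U Ja PU) => b Fb Jb; split=> //; exact: Fb.
  have : nbhs a (~` J).
    by apply: open_nbhs_nbhs; split=> //; exact: closed_openC.
  by apply: filterS => b nJb /nJb.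
move=> a U _ PU; near=> b => -[Kb|Lb].
  have [Ka E] : K a /\ G b - G a = U b - U a.
    by move: Kb; near: b; exact: nearJ.
  by rewrite !onK.
have [La E] : L a /\ H b - H a = U b - U a.
  by move: Lb; near: b; exact: nearJ.
by rewrite !onL// opprD addrACA subrr addr0.
Unshelve. all: by end_near. Qed.

End Potentials.

(** * Potentials on the plane *)

Definition rect (R : realType) (s t u v : R) : set (plane R) :=
  [set a | s <= a 0 0 <= t /\ u <= a 1 0 <= v].

Lemma rect_sub (R : realType) (s t u v s' t' u' v' : R) :
  s' <= s -> t <= t' -> u' <= u -> v <= v' ->
  rect s t u v `<=` rect s' t' u' v'.
Proof.
by move=> ? ? ? ? a [/andP[? ?] /andP[? ?]]; split; apply/andP; split; lra.
Qed.

Lemma entry_continuous (R : realType) (i : 'I_2) :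
  continuous (fun a : plane R => a i 0).
Proof. exact: coord_continuous. Qed.

Lemma rect_closed (R : realType) (s t u v : R) : closed (rect s t u v).
Proof.
rewrite (_ : rect s t u v =
    ((fun a : plane R => a 0 0) @^-1` `[s, t]) `&`
    ((fun a : plane R => a 1 0) @^-1` `[u, v])).
  by apply: closedI; apply: preimage_closed;
    try (move=> a _; exact: entry_continuous); exact: itv_closed.
by apply/seteqP; split=> a /=; rewrite !in_itv.
Qed.

Lemma rect_convex (R : realType) (s t u v : R) (a b : plane R) (k : R) :
  rect s t u v a -> rect s t u v b -> 0 <= k <= 1 ->
  rect s t u v (a + k *: (b - a)).
Proof.
move=> [/andP[? ?] /andP[? ?]] [/andP[? ?] /andP[? ?]] /andP[? ?].
by split; rewrite !mxE; apply/andP; split; nra.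
Qed.

Lemma rect_connected (R : realType) (s t u v : R) : connected (rect s t u v).
Proof. by apply: convex_connected => *; exact: rect_convex. Qed.

Lemma rect_splitx (R : realType) (s m t u v : R) : s <= m -> m <= t ->
  rect s t u v = rect s m u v `|` rect m t u v.
Proof.
move=> sm mt; apply/seteqP; split=> a; rewrite /rect /=.
  move=> [/andP[? ?] ?]; have [am|ma] := leP (a 0 0) m; [left|right];
  by split=> //; apply/andP; split; lra.
by move=> [[/andP[? ?] ?]|[/andP[? ?] ?]]; split=> //; apply/andP; split; lra.
Qed.

Lemma rect_meetx (R : realType) (s m t u v : R) : s <= m -> m <= t ->
  rect s m u v `&` rect m t u v = rect m m u v.
Proof.
move=> sm mt; apply/seteqP; split=> a; rewrite /rect /=.
  move=> [[/andP[? ?] ?] [/andP[? ?] _]].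
  by split=> //; apply/andP; split; lra.
by move=> [/andP[? ?] ?]; split; split=> //; apply/andP; split; lra.
Qed.

Lemma rect_splity (R : realType) (s t u m v : R) : u <= m -> m <= v ->
  rect s t u v = rect s t u m `|` rect s t m v.
Proof.
move=> um mv; apply/seteqP; split=> a; rewrite /rect /=.
  move=> [? /andP[? ?]]; have [am|ma] := leP (a 1 0) m; [left|right];
  by split=> //; apply/andP; split; lra.
by move=> [[? /andP[? ?]]|[? /andP[? ?]]]; split=> //; apply/andP; split; lra.
Qed.

Lemma rect_meety (R : realType) (s t u m v : R) : u <= m -> m <= v ->
  rect s t u m `&` rect s t m v = rect s t m m.
Proof.
move=> um mv; apply/seteqP; split=> a; rewrite /rect /=.
  move=> [[? /andP[? ?]] [_ /andP[? ?]]].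
  by split=> //; apply/andP; split; lra.
by move=> [? /andP[? ?]]; split; split=> //; apply/andP; split; lra.
Qed.

Lemma nbhs_rect (R : realType) (a : plane R) (A : set (plane R)) :
  nbhs a A -> exists2 d, 0 < d &
    rect (a 0 0 - d) (a 0 0 + d) (a 1 0 - d) (a 1 0 + d) `<=` A.
Proof.
move=> /nbhs_ballP[e /= e0 eA]; exists (e / 2); first by rewrite divr_gt0.
move=> b [/andP[? ?] /andP[? ?]]; apply: eA; split=> // i j.
rewrite (ord1 j) /ball /= ltr_norml.
have [->|->] : i = 0 \/ i = 1.
- by case: i => [[|[|//]]] ?; [left|right]; exact/val_inj.
- by apply/andP; split; lra.
- by apply/andP; split; lra.
Qed.

Section PlanePotentials.
Variables (R : realType) (V : zmodType).
Variable P : plane R -> (plane R -> V) -> Prop.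
Hypothesis P_ex : forall a, exists U, P a U.
Hypothesis P_open : forall a U, P a U -> \forall b \near a, P b U.
Hypothesis P_uniq : forall a U U', P a U -> P a U' ->
  \forall b \near a, U b - U a = U' b - U' a.

Lemma has_primitive_near (a : plane R) : exists2 d, 0 < d &
  has_primitive P (rect (a 0 0 - d) (a 0 0 + d) (a 1 0 - d) (a 1 0 + d)).
Proof.
have [U PU] := P_ex a; have [d d0 dP] := nbhs_rect (P_open PU).
exists d => //; exists U => b U' /dP PbU PbU'.
by apply: filterS (P_uniq PbU PbU') => c ->.
Qed.

(** A horizontal segment has a thin neighbourhood on which a primitive exists,
by induction over its length (the thickness of a concatenation being the smaller
one); then induction over the height stacks these strips. *)
Lemma has_primitive_rect (s t u v : R) : s <= t -> u <= v ->
  has_primitive P (rect s t u v).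
Proof.
move=> st; move: u v.
have strip y : exists2 d, 0 < d & has_primitive P (rect s t (y - d) (y + d)).
  move: s t st; apply: interval_induction.
    move=> s m t /andP[sm mt] [d1 d10 G1] [d2 d20 G2].
    exists (Num.min d1 d2); first by rewrite lt_min d10.
    set d := Num.min d1 d2.
    have dd1 : d <= d1 by rewrite ge_min lexx.
    have dd2 : d <= d2 by rewrite ge_min lexx orbT.
    have -> : rect s t (y - d) (y + d) =
        rect s m (y - d) (y + d) `|` rect m t (y - d) (y + d).
      exact: rect_splitx.
    apply: (has_primitive_glue P_ex); try exact: rect_closed.
    - by rewrite (rect_meetx _ _ sm mt); exact: rect_connected.
    - by apply: has_primitive_sub G1; apply: rect_sub; lra.
    - by apply: has_primitive_sub G2; apply: rect_sub; lra.
  move=> x; pose a : plane R := \col_i (if i == 0 then x else y).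
  have [d d0] := has_primitive_near a; rewrite !mxE /= => Gd.
  exists d => // s t xs /andP[? ?] tx; exists d => //.
  by apply: has_primitive_sub Gd; apply: rect_sub; lra.
apply: interval_induction.
  move=> u m v /andP[um mv] G1 G2; rewrite (rect_splity s t um mv).
  apply: (has_primitive_glue P_ex) => //; try exact: rect_closed.
  by rewrite (rect_meety _ _ um mv); exact: rect_connected.
move=> y; have [d d0 Gd] := strip y.
exists d => // u v ? /andP[? ?] ?.
by apply: has_primitive_sub Gd; apply: rect_sub; lra.
Qed.

(** Primitives on growing squares, normalized to vanish at 0, agree on common
points, so at each point the value on any square containing it will do. *)
Lemma plane_primitive : exists F : plane R -> V, forall a U, P a U ->
  \forall b \near a, F b - F a = U b - U a.
Proof.
pose B (n : nat) := rect (- n%:R) n%:R (- n%:R) (n%:R : R).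
have /choice[G GP] n : has_primitive P (B n).
  by apply: has_primitive_rect; have := ler0n R n; lra.
have B0 n : B n 0 by split; rewrite mxE lerNl oppr0 !ler0n.
have Bmono m n : (m <= n)%N -> B m `<=` B n.
  by move=> mn; apply: rect_sub; rewrite ?lerN2 ler_nat.
have GG m n a : B m a -> B n a -> G m a - G m 0 = G n a - G n 0.
  wlog mn : m n / (m <= n)%N.
    move=> wl; have [mn|/ltnW nm] := leqP m n => ? ?; first exact: wl.
    by apply/esym; exact: wl.
  move=> Bma _; apply: (@primitive_unique _ _ P P_ex (B m)) => //.
    exact: rect_connected.
  by apply: primitive_on_sub (GP n); exact: Bmono.
have /choice[N NP] (a : plane R) : exists n : nat, B n a.
  exists (Num.truncn (`|a 0 0| + `|a 1 0|)).+1.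
  have := truncnS_gt (`|a 0 0| + `|a 1 0|) => aN.
  have ? := normr_ge0 (a 0 0); have ? := normr_ge0 (a 1 0).
  by split; rewrite -ler_norml; lra.
exists (fun a => G (N a) a - G (N a) 0) => a U PU.
have FE n b : B n b -> G (N b) b - G (N b) 0 = G n b - G n 0.
  by move=> Bb; exact: GG.
(* The margin between the squares N a and N a + 1 contains a neighbourhood of a,
   even when a lies on the edge of the smaller one. *)
have nB : \forall b \near a, B (N a).+1 b.
  have [d d0 dB] : exists2 d, 0 < d & rect (a 0 0 - d) (a 0 0 + d) (a 1 0 - d)
      (a 1 0 + d) `<=` B (N a).+1.
    exists 1 => //; have [/andP[? ?] /andP[? ?]] := NP a.
    by apply: rect_sub; rewrite -natr1; lra.
  apply: filterS dB _; apply/nbhs_ballP; exists d => //= b ab.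
  have := ab.2 0 0; have := ab.2 1 0; rewrite /ball /= !ltr_norml.
  by move=> /andP[? ?] /andP[? ?]; split; apply/andP; split; lra.
have BaS : B (N a).+1 a by apply: Bmono (NP a).
have := GP (N a).+1 a U BaS PU; apply: filterS2 nB => b Bb /(_ Bb) <-.
by rewrite (FE _ _ Bb) (FE _ _ BaS) opprB addrA subrK.
Qed.

End PlanePotentials.

(** * Differentials of maps on the plane *)

Lemma near_eq_is_diff (R : numFieldType) (V W : normedModType R)
    (f g : V -> W) (x : V) :
  (\forall y \near x, f y = g y) -> differentiable f x ->
  is_diff x g ('d f x).
Proof.
move=> fg df.
have gE : g \o shift x = cst (g x) + 'd f x +o_ 0 id.
  have /eqaddoP fE := diff_locally df.
  apply/eqaddoP => e e0; have := fE e e0; apply: filter_app.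
  have {}fg : \forall h \near (0 : V), f (h + x) = g (h + x).
    by move: fg; rewrite (near_shift 0) subr0.
  have E : f x = g x by move: (nbhs_singleton fg); rewrite add0r.
  near=> h; rewrite /= !fctE /= -E.
  by have <- // : f (h + x) = g (h + x) by near: h.
have cdf : continuous ('d f x) by exact: diff_continuous.
have dgE := diff_unique cdf gE.
by split=> //; apply/diff_locallyP; rewrite dgE.
Unshelve. all: by end_near. Qed.

Lemma jac_mulmx (R : realType) (F : plane R -> plane R) (a v : plane R) :
  jac F a *m v = 'd F a v.
Proof.
rewrite [v in RHS](_ : v = \sum_j v j 0 *: delta_mx j 0); last first.
  by rewrite [LHS]matrix_sum_delta; apply: eq_bigr => i _; rewrite big_ord1.
rewrite linear_sum; apply/matrixP => i k; rewrite (ord1 k) !mxE summxE.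
by apply: eq_bigr => j _; rewrite linearZ !mxE mulrC.
Qed.

Lemma mulmx_continuous (R : realType) m (M : 'M[R]_(m.+1, 2)) :
  continuous (mulmx M : plane R -> 'cV[R]_m.+1).
Proof.
move=> a.
have -> : mulmx M = fun b : plane R => b 0 0 *: col 0 M + b 1 0 *: col 1 M.
  apply/funext => b; apply/matrixP => i k; rewrite !mxE.
  rewrite !big_ord_recl big_ord0 addr0 !(ord1 k) mulrC (mulrC (M i _)).
  by rewrite (_ : lift 0 0 = 1) //; exact/val_inj.
have e0 := @entry_continuous R 0 a; have e1 := @entry_continuous R 1 a.
exact: (cvgD (cvgZr_tmp e0) (cvgZr_tmp e1)).
Qed.

Lemma is_diff_mulmx (R : realType) m (M : 'M[R]_(m.+1, 2)) (a : plane R) :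
  is_diff a (mulmx M : plane R -> 'cV[R]_m.+1) (mulmx M).
Proof.
split; first by apply: linear_differentiable; exact: mulmx_continuous.
by apply: diff_lin; exact: mulmx_continuous.
Qed.

Lemma is_diff_aff_act (R : realType) (g : aff R) (a : plane R) :
  is_diff a (aff_act g) (mulmx g.1).
Proof.
have := is_diff_mulmx g.1 a => ?.
by apply: is_diff_eq (is_diffD _ _) _; rewrite addr0.
Qed.

Lemma is_diff_row_mulmx (R : realType) (r : 'rV[R]_2) (a : plane R) :
  is_diff a (fun u : plane R => (r *m u) 0 0 : R) (fun u => (r *m u) 0 0).
Proof.
have r_lin : linear (fun u : plane R => (r *m u) 0 0 : R^o).
  by move=> k u v; rewrite mulmxDr -scalemxAr !mxE.
pose rM := GRing.isLinear.Build _ _ _ _ _ r_lin.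
pose L : {linear plane R -> R^o} :=
  HB.pack (fun u : plane R => (r *m u) 0 0 : R^o) rM.
have cL : continuous L.
  move=> u; have e0 := @entry_continuous R 0 u.
  have e1 := @entry_continuous R 1 u.
  have -> : (L : plane R -> R) =
      fun u : plane R => r 0 0 * u 0 0 + r 0 1 * u 1 0.
    apply/funext => b; rewrite /L /= !mxE !big_ord_recl big_ord0 addr0.
    by rewrite (_ : lift ord0 ord0 = 1) //; exact/val_inj.
  exact: (cvgD (cvgM (cvg_cst _) e0) (cvgM (cvg_cst _) e1)).
have -> : (fun u : plane R => (r *m u) 0 0) = L by [].
by split; [exact: linear_differentiable|exact: diff_lin].
Qed.

Lemma smooth_on_C1 (R : realType) (V W : normedModType R) (U : set V)
    (F : V -> W) : smooth_on U F ->
  forall a, U a -> differentiable F a /\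
    forall v, {for a, continuous (fun b => 'd F b v)}.
Proof. by move=> /(_ 1%N)[dF cF] a Ua; split=> [|v]; [exact: dF|exact: cF]. Qed.

(** * The standard torus *)

Local Notation int_vec R z := (map_mx intr z : plane R).

Lemma torus_projP (R : realType) (a b : plane R) :
  torus_proj a = torus_proj b <-> exists z : 'cV[int]_2, b = a + int_vec R z.
Proof.
set Q := quot (lattice_group (1%:M : 'M[R]_2)).
have piP : orbit_rel (lattice_group (1%:M : 'M[R]_2)) a b <-> \pi_Q a = \pi_Q b.
  by rewrite -(@eqquotE _ _ Q); split => /eqP.
apply: iff_trans (iff_sym piP) _.
split=> [/asboolP[[g1 g2] [/= -> [z ->]] ->]|[z ->]].
  by exists z; rewrite /aff_act/= !mul1mx.
apply/asboolP; exists (1%:M, int_vec R z); last by rewrite /aff_act/= mul1mx.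
by split=> //; exists z; rewrite mul1mx.
Qed.

Lemma torus_proj_surj (R : realType) (x : T2 R) : exists a, x = torus_proj a.
Proof. by exists (repr (x : quot _)); rewrite /torus_proj reprK. Qed.

Lemma torus_projD (R : realType) (a : plane R) (z : 'cV[int]_2) :
  torus_proj (a + int_vec R z) = torus_proj a.
Proof. by symmetry; apply/torus_projP; exists z. Qed.

Lemma torus_proj_continuous (R : realType) : continuous (@torus_proj R).
Proof. exact: pi_continuous. Qed.

(** The saturation of V is the union of its integer translates. *)
Lemma torus_proj_open (R : realType) (V : set (plane R)) :
  open V -> open (@torus_proj R @` V : set (T2 R)).
Proof.
move=> oV; rewrite /open /= /quotient_open.
rewrite (_ : _ @^-1` _ = \bigcup_z ((fun a => a + int_vec R z) @^-1` V)).
  apply: bigcup_open => z _; apply: open_comp oV => a _.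
  exact: (cvgD cvg_id (cvg_cst _)).
apply/seteqP; split=> a /=.
  move=> [b Vb /esym ab].
  have /torus_projP[z bE] : torus_proj a = torus_proj b by [].
  by exists z => //=; rewrite -bE.
by move=> [z _ /= Vaz]; exists (a + int_vec R z) => //; exact: torus_projD.
Qed.

(** The atlas of the torus is defined by a compatibility condition; charts in it
around every point are needed, both to use the smoothness of f and because the
integrand of a path integral is evaluated in some chart.  The projection of a
ball of radius 1/2 (for the sup norm) is injective and open, so its inverse is
such a chart. *)
Section TorusChart.
Variables (R : realType) (a0 : plane R).

Let D : set (plane R) := ball a0 (1 / 2).

Let torus_proj_inj (a b : plane R) : D a -> D b ->
  torus_proj a = torus_proj b -> a = b.
Proof.
move=> [_ aD] [_ bD] /torus_projP[z bE].
suff z0 : z = 0 by rewrite bE z0 map_mx0 addr0.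
apply/matrixP => i j; rewrite (ord1 j) [RHS]mxE.
have := aD i 0; have := bD i 0; rewrite bE !mxE /ball /= !ltr_norml.
move=> /andP[? ?] /andP[? ?].
have zlt : `|(z i 0)%:~R| < 1 :> R by rewrite ltr_norml; apply/andP; split; lra.
by move: zlt; rewrite -intr_norm ltrz1; case: (z i 0) => [[|n]|n].
Qed.

Let rep (x : T2 R) : plane R := get [set a | D a /\ torus_proj a = x].

Let repK a : D a -> rep (torus_proj a) = a.
Proof.
move=> Da; apply: get_unique; first by split.
by move=> b [Db ba]; exact: torus_proj_inj.
Qed.

Let rep_cont x : (@torus_proj R @` D) x -> {for x, continuous rep}.
Proof.
move=> [a Da <-] A /=; rewrite repK// => nA.
have : nbhs a (interior (A `&` D)).
  apply: open_nbhs_nbhs; split; first exact: open_interior.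
  apply: filterI => //; apply: open_nbhs_nbhs; split=> //; exact: ball_open.
move=> /nbhs_singleton Ia.
apply: (@filterS _ _ _ (@torus_proj R @` interior (A `&` D))); last first.
  apply: open_nbhs_nbhs; split; first exact/torus_proj_open/open_interior.
  by exists a.
by move=> _ [b /interior_subset[Ab Db] <-]; rewrite /= repK.
Qed.

Definition torus_chart : chart R (T2 R).
Proof.
refine (@Chart R (T2 R) (@torus_proj R @` D) D rep (@torus_proj R)
  _ _ _ _ _ _ _ _).
- exact/torus_proj_open/ball_open.
- exact: ball_open.
- by move=> _ [a Da <-]; rewrite repK.
- by move=> a Da; exists a.
- by move=> _ [a Da <-]; rewrite repK.
- by move=> a Da; rewrite repK.
- exact: rep_cont.
- by move=> a _; exact: torus_proj_continuous.
Defined.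

Lemma torus_chart_atlas : atlas torus_chart.
Proof.
move=> b [a Da /torus_projP[z bE]].
exists (1%:M, - int_vec R z); split; first by rewrite det1.
(* Near b = a + z the representative in the ball is obtained by translation
   by - z. *)
have nD : \forall y \near b, D (y - int_vec R z).
  have : open D by exact: ball_open.
  rewrite openE => /(_ a Da) /=.
  have -> : a = b - int_vec R z by rewrite bE addrK.
  move=> h; have : (fun y : plane R => y - int_vec R z) @ b --> b - int_vec R z.
    exact: (cvgB cvg_id (cvg_cst _)).
  exact.
apply: filterS nD => y Dy.
rewrite /aff_act /= mul1mx -[in LHS](subrK (int_vec R z) y).
by have := repK Dy; rewrite -{1}(torus_projD _ z).
Qed.

End TorusChart.

(** * The form eta is parallel *)

Definition tensorial_form1 (R : realType) (M : atlasSpace R) (th : form1 M) :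
    Prop :=
  forall (c c' : chart R M) x g, atlas c -> atlas c' -> dom c x -> dom c' x ->
    aff_near (coord c) (coord c') g x -> th c x = th c' x *m g.1.

Lemma det_row_mx2 (R : comNzRingType) (z v : 'cV[R]_2) :
  \det (row_mx z v) = z 0 0 * v 1 0 - v 0 0 * z 1 0.
Proof.
have E0 i : row_mx z v i 0 = z i 0.
  by rewrite -(row_mxEl z v); congr (row_mx _ _ _ _); exact/val_inj.
have E1 i : row_mx z v i 1 = v i 0.
  by rewrite -(row_mxEr z v); congr (row_mx _ _ _ _); exact/val_inj.
have l01 : lift 0 0 = 1 :> 'I_2 by exact/val_inj.
have l10 : lift 1 0 = 0 :> 'I_2 by exact/val_inj.
have C0 : row' 0 (col' 0 (row_mx z v)) 0 0 = v 1 0 by rewrite 2!mxE l01 E1.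
have C1 : row' 0 (col' 1 (row_mx z v)) 0 0 = z 1 0 by rewrite 2!mxE l01 l10 E0.
rewrite (expand_det_row _ 0) !big_ord_recl big_ord0 addr0 /cofactor !det_mx11.
by rewrite l01 C0 C1 E0 E1 expr0 expr1 mul1r mulN1r mulrN.
Qed.

Lemma row_det_mulmx (R : comNzRingType) (z v : 'cV[R]_2) :
  ((\row_j \det (row_mx z (delta_mx j 0))) *m v) 0 0 = \det (row_mx z v).
Proof.
rewrite !mxE !big_ord_recl big_ord0 !mxE !det_row_mx2 !mxE /=.
rewrite (_ : lift ord0 ord0 = 1); last exact/val_inj.
rewrite !(mulr0, mul1r, mulr1, mul0r, sub0r, subr0, addr0).
by rewrite addrC mulNr (mulrC (z 1 0)).
Qed.

(** The fields omega and zeta are specified as parallel tensor fields, and so is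
the zero field that replaces them when the specification cannot be met; hence
these properties hold unconditionally. *)
Section EtaForm.
Variables (R : realType) (M : atlasSpace R).

Lemma omega_M_parallel : parallel (@omega_M R M).
Proof.
rewrite /omega_M; case: xgetP => [w _ []//|_].
by move=> c x _ _; exact: nearW.
Qed.

Lemma omega_M_tensorial : tensorial_form2 (@omega_M R M).
Proof.
rewrite /omega_M; case: xgetP => [w _ []//|_].
by move=> c c' x g *; rewrite mul0r.
Qed.

Lemma zeta_M_parallel : parallel (@zeta_M R M).
Proof.
rewrite /zeta_M; case: xgetP => [Z _ []//|_].
by move=> c x _ _; exact: nearW.
Qed.

Lemma zeta_M_tensorial : tensorial_vfield (@zeta_M R M).
Proof.
rewrite /zeta_M; case: xgetP => [Z _ []//|_].
by move=> c c' x g *; rewrite mulmx0.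
Qed.

Lemma eta_M_parallel : parallel (@eta_M R M).
Proof.
move=> c x ac cx.
have nw := omega_M_parallel ac cx; have nz := zeta_M_parallel ac cx.
near=> y; apply/rowP => j; rewrite /eta_M /Defs.interior !mxE /form2_eval.
have -> : omega_M c y = omega_M c x by near: y.
have -> // : zeta_M c y = zeta_M c x by near: y.
Unshelve. all: by end_near. Qed.

(** When a change of charts has linear part g, the determinant of (zeta, v) is
multiplied by that of g, and the coefficient of omega is divided by it. *)
Lemma eta_M_tensorial : tensorial_form1 (@eta_M R M).
Proof.
move=> c c' x g ac ac' cx c'x gcc'.
have etaE (d : chart R M) (v : plane R) :
    (eta_M d x *m v) 0 0 = omega_M d x * \det (row_mx (zeta_M d x) v).
  rewrite -row_det_mulmx !mxE mulr_sumr; apply: eq_bigr => j _.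
  by rewrite /eta_M /Defs.interior !mxE mulrA.
apply/rowP => j.
have entryE (r : 'rV[R]_2) : r 0 j = (r *m (delta_mx j 0 : plane R)) 0 0.
  by rewrite -colE !mxE.
rewrite !entryE -mulmxA !etaE (zeta_M_tensorial ac ac' cx c'x gcc') -mul_mx_row.
by rewrite det_mulmx mulrA -(omega_M_tensorial ac ac' cx c'x gcc').
Qed.

End EtaForm.

(** * The primitive of the pulled back form and its periods *)

Section Potential.
Variables (R : realType) (M : atlasSpace R) (f : T2 R -> M) (th : form1 M).
Hypothesis M_charts : forall x : M, exists2 c, atlas c & dom c x.
Hypothesis M_compat :
  forall c c' : chart R M, atlas c -> atlas c' -> compatible c c'.
Hypothesis f_smooth : smooth_map f.
Hypothesis th_par : parallel th.
Hypothesis th_tens : tensorial_form1 th.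

Let phi (a : plane R) : M := f (torus_proj a).

Let phi_continuous : continuous phi.
Proof.
move=> a; apply: continuous_comp; first exact: torus_proj_continuous.
exact: f_smooth.1.
Qed.

Let near_phi_dom (c : chart R M) a :
  dom c (phi a) -> \forall b \near a, dom c (phi b).
Proof.
move=> ca; apply: phi_continuous; apply: open_nbhs_nbhs; split=> //.
exact: dom_open.
Qed.

(** In the chart of the torus around a, whose parametrization is the projection
itself, smoothness of f is smoothness of phi. *)
Let lift_C1 (c : chart R M) a : atlas c -> dom c (phi a) ->
  differentiable (coord c \o phi) a /\
  forall v, {for a, continuous (fun b => 'd (coord c \o phi) b v)}.
Proof.
move=> ac ca.
have := smooth_on_C1 (f_smooth.2 (torus_chart a) c (@torus_chart_atlas R a) ac).
move=> /(_ a); apply; split => //.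
by apply: ballxx; rewrite divr_gt0.
Qed.

(** Where th has constant coefficients, it is the differential of the affine
function th *m coord of the coordinates. *)
Definition local_potential (a : plane R) (U : plane R -> R) : Prop :=
  exists c k, [/\ atlas c, dom c (phi a) &
    \forall b \near a, U b = (th c (phi b) *m coord c (phi b)) 0 0 + k].

Lemma local_potential_ex a : exists U, local_potential a U.
Proof.
have [c ac ca] := M_charts (phi a).
exists (fun b => (th c (phi b) *m coord c (phi b)) 0 0).
exists c, 0; split=> //.
by near=> b; rewrite addr0.
Unshelve. all: by end_near.
Qed.

Lemma local_potential_open a U :
  local_potential a U -> \forall b \near a, local_potential b U.
Proof.
move=> [c [k [ac ca UE]]]; have UE' := near_join UE; near=> b.
exists c, k; split=> //; last by near: b.
by near: b; exact: near_phi_dom.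
Unshelve. all: by end_near. Qed.

(** Passing to another chart by x |-> g x + b changes th *m coord by th *m b,
which is locally constant as th is parallel. *)
Lemma local_potential_uniq a U V : local_potential a U -> local_potential a V ->
  \forall b \near a, U b - U a = V b - V a.
Proof.
move=> [c [k [ac ca UE]]] [d [l [ad da VE]]].
have [g [g0 gE]] := M_compat ac ad ca da.
have ggE : \forall b \near a, aff_near (coord c) (coord d) g (phi b).
  have gjoin : \forall x \near phi a, aff_near (coord c) (coord d) g x.
    by apply: filterS (near_join gE) => y; split.
  exact: phi_continuous gjoin.
have thd : \forall b \near a, th d (phi b) = th d (phi a).
  exact: phi_continuous (th_par ad da).
have UV : \forall b \near a, U b - V b = k - l - (th d (phi a) *m g.2) 0 0.
  near=> b.
  have -> : U b = (th c (phi b) *m coord c (phi b)) 0 0 + k by near: b.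
  have -> : V b = (th d (phi b) *m coord d (phi b)) 0 0 + l by near: b.
  have cb : dom c (phi b) by near: b; exact: near_phi_dom.
  have db : dom d (phi b) by near: b; exact: near_phi_dom.
  have gb : aff_near (coord c) (coord d) g (phi b) by near: b.
  rewrite (th_tens ac ad cb db gb) (nbhs_singleton gb.2) /aff_act.
  have -> : th d (phi b) = th d (phi a) by near: b.
  rewrite mulmxDr -mulmxA [X in _ - (X + l)]mxE; ring.
near=> b.
have Eb : U b - V b = k - l - (th d (phi a) *m g.2) 0 0 by near: b.
have Ea := nbhs_singleton UV.
lra.
Unshelve. all: by end_near. Qed.

Lemma local_potential_translate a z U : local_potential (a + int_vec R z) U ->
  local_potential a (fun b => U (b + int_vec R z)).
Proof.
have phiz b : phi (b + int_vec R z) = phi b by rewrite /phi torus_projD.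
move=> [c [k [ac]]]; rewrite phiz => ca UE; exists c, k; split=> //.
have cz : (fun b : plane R => b + int_vec R z) @ a --> a + int_vec R z.
  exact: (cvgD cvg_id (cvg_cst _)).
have UzE : \forall b \near a, U (b + int_vec R z) =
  (th c (phi (b + int_vec R z)) *m coord c (phi (b + int_vec R z))) 0 0 + k.
  exact: cz _ UE.
by apply: filterS UzE => b ->; rewrite phiz.
Qed.

Variable F : plane R -> R.
Hypothesis F_prim : forall a U, local_potential a U ->
  \forall b \near a, F b - F a = U b - U a.

(** Translates of potentials by z are potentials, so the difference is locally
constant on the plane. *)
Lemma primitive_translate (a : plane R) (z : 'cV[int]_2) :
  F (a + int_vec R z) - F a = F (int_vec R z) - F 0.
Proof.
suff /(_ a 0) : forall b c : plane R,
    F (b + int_vec R z) - F b = F (c + int_vec R z) - F c by rewrite add0r.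
move=> b0 c0.
apply: (@locally_constant_connected (plane R) R setT
  (fun b => F (b + int_vec R z) - F b) _ _ b0 c0) => //.
  exact: (@convex_connected R (plane R)).
move=> {}a _; have [U PU] := local_potential_ex (a + int_vec R z).
have cz : (fun b : plane R => b + int_vec R z) @ a --> a + int_vec R z.
  exact: (cvgD cvg_id (cvg_cst _)).
have H1 : \forall b \near a, F (b + int_vec R z) - F (a + int_vec R z) =
  U (b + int_vec R z) - U (a + int_vec R z) by exact: cz _ (F_prim PU).
have H2 := F_prim (local_potential_translate PU).
near=> b => _.
have E1 : F (b + int_vec R z) - F (a + int_vec R z) =
  U (b + int_vec R z) - U (a + int_vec R z) by near: b.
have E2 : F b - F a = U (b + int_vec R z) - U (a + int_vec R z) by near: b.
lra.
Unshelve. all: by end_near. Qed.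

Lemma primitive_near (c : chart R M) a : atlas c -> dom c (phi a) ->
  exists k, \forall b \near a, F b = (th c (phi a) *m coord c (phi b)) 0 0 + k.
Proof.
move=> ac ca.
pose U b := (th c (phi b) *m coord c (phi b)) 0 0.
have PU : local_potential a U.
  by exists c, 0; split=> //; near=> b; rewrite addr0.
exists (F a - U a).
have thc : \forall b \near a, th c (phi b) = th c (phi a).
  exact: phi_continuous (th_par ac ca).
have FU := F_prim PU.
near=> b.
have <- : th c (phi b) = th c (phi a) by near: b.
have E : F b - F a = U b - U a by near: b.
by move: E; rewrite /U => E; lra.
Unshelve. all: by end_near. Qed.

(** The differential of F is the pullback of th by phi: this is where F, built
from potentials alone, is connected with the form. *)
Lemma primitive_is_diff (c : chart R M) a : atlas c -> dom c (phi a) ->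
  is_diff a F (fun v => (th c (phi a) *m 'd (coord c \o phi) a v) 0 0).
Proof.
move=> ac ca; have [k FE] := primitive_near ac ca.
have dW := differentiableP (lift_C1 ac ca).1.
have dr := is_diff_row_mulmx (th c (phi a)) ((coord c \o phi) a).
have dG := is_diffD (is_diff_comp dW dr) (is_diff_cst (k : R^o) a).
have GF : \forall b \near a,
    (((fun u : plane R => (th c (phi a) *m u) 0 0 : R) \o (coord c \o phi)) +
     cst (k : R^o)) b = F b.
  by apply: filterS FE => b ->.
have dF := near_eq_is_diff GF (@ex_diff _ _ _ _ _ _ _ dG).
split; first exact: (@ex_diff _ _ _ _ _ _ _ dF).
rewrite (@diff_val _ _ _ _ _ _ _ dF) (@diff_val _ _ _ _ _ _ _ dG).
by apply/funext => v; rewrite !fctE /= addr0.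
Qed.

Lemma primitive_differentiable a : differentiable F a.
Proof.
have [c ac ca] := M_charts (phi a).
exact: (@ex_diff _ _ _ _ _ _ _ (primitive_is_diff ac ca)).
Qed.

Lemma primitive_diff_continuous (v : plane R) :
  continuous (fun a => 'd F a v : R).
Proof.
move=> a; have [c ac ca] := M_charts (phi a).
have E : \forall b \near a,
    'd F b v = (th c (phi a) *m 'd (coord c \o phi) b v) 0 0.
  have thc : \forall b \near a, th c (phi b) = th c (phi a).
    exact: phi_continuous (th_par ac ca).
  near=> b.
  have cb : dom c (phi b) by near: b; exact: near_phi_dom.
  rewrite (@diff_val _ _ _ _ _ _ _ (primitive_is_diff ac cb)).
  by have -> : th c (phi b) = th c (phi a) by near: b.
have cW := (lift_C1 ac ca).2 v.
have dr := is_diff_row_mulmx (th c (phi a)) ('d (coord c \o phi) a v).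
have cr := differentiable_continuous (@ex_diff _ _ _ _ _ _ _ dr).
have cc : {for a, continuous
    ((fun u : plane R => (th c (phi a) *m u) 0 0 : R) \o
     (fun b => 'd (coord c \o phi) b v))} by exact: continuous_comp.
pose G b : R := (th c (phi a) *m 'd (coord c \o phi) b v) 0 0.
have {}cc : G @ a --> G a by exact: cc.
have {}E : \forall b \near a, G b = 'd F b v by apply: filterS E => b ->.
have Ea := nbhs_singleton E.
suff : (fun b => 'd F b v : R) @ a --> G a by rewrite Ea.
exact: cvg_trans (near_eq_cvg E) cc.
Unshelve. all: by end_near. Qed.

Section Curve.
Variable A : 'M[int]_2.
Let AR : 'M[R]_2 := map_mx intr A.

(** Composed with the projection of the plane, a chart of the torus is an affine
map g near each point; so in this chart the map induced by A lifts to A after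
the inverse of g. *)
Let torus_map_lift (c : chart R (T2 R)) (a : plane R) :
  atlas c -> dom c (torus_proj a) ->
  exists g : aff R, [/\ g.1 \in unitmx,
    \forall b \near a, coord c (torus_proj b) = aff_act g b &
    \forall y \near coord c (torus_proj a),
      f (torus_map A (param c y)) = phi (AR *m aff_act (aff_inv g) y)].
Proof.
move=> ac ca; have [g [g0 gE0]] := ac a ca.
have gE : \forall b \near a, coord c (torus_proj b) = aff_act g b by exact: gE0.
have gu : g.1 \in unitmx by rewrite unitmxE unitfE gt_eqF.
exists g; split=> //.
have gK b : aff_act g (aff_act (aff_inv g) b) = b.
  by rewrite /aff_act /= mulmxDr mulmxN !mulmxA mulmxV // !mul1mx subrK.
have gK' b : aff_act (aff_inv g) (aff_act g b) = b.
  by rewrite /aff_act /= mulmxDr !mulmxA mulVmx // !mul1mx addrK.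
have ya : aff_act (aff_inv g) (coord c (torus_proj a)) = a.
  by rewrite (nbhs_singleton gE) gK'.
have ginv : aff_act (aff_inv g) @ coord c (torus_proj a) --> a.
  rewrite -[X in _ --> X]ya; apply: differentiable_continuous.
  exact: (@ex_diff _ _ _ _ _ _ _ (is_diff_aff_act _ _)).
have cdom : \forall b \near a, dom c (torus_proj b).
  apply: torus_proj_continuous; apply: open_nbhs_nbhs; split=> //.
  exact: dom_open.
have n1 : \forall y \near coord c (torus_proj a),
    coord c (torus_proj (aff_act (aff_inv g) y)) =
    aff_act g (aff_act (aff_inv g) y).
  exact: ginv _ gE.
have n2 : \forall y \near coord c (torus_proj a),
    dom c (torus_proj (aff_act (aff_inv g) y)).
  exact: ginv _ cdom.
near=> y.
rewrite /phi -torus_mapE; congr (f (torus_map A _)).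
have dy : dom c (torus_proj (aff_act (aff_inv g) y)) by near: y.
have yE : coord c (torus_proj (aff_act (aff_inv g) y)) = y.
  by rewrite -[RHS]gK; near: y.
by rewrite -[in LHS]yE coordK.
Unshelve. all: by end_near. Qed.

(** Chain rule along the curve s |-> A (s u): the affine map g of the chart c
enters once through the velocity in c and once, inverted, through the jacobian,
and cancels. *)
Lemma pullback_velocity (c : chart R (T2 R)) (c' : chart R M) (u : plane R) t :
  atlas c -> atlas c' -> dom c (torus_proj (t *: u)) ->
  dom c' (phi (AR *m (t *: u))) ->
  jac (coord c' \o (f \o torus_map A) \o param c)
      (coord c (torus_proj (t *: u)))
    *m ((coord c \o (fun s => torus_proj (s *: u)))^`()%classic t) =
  'd (coord c' \o phi) (AR *m (t *: u)) (AR *m u).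
Proof.
move=> ac ac' ct c't.
have [g [gu gE fE]] := torus_map_lift ac ct.
set y0 := coord c (torus_proj (t *: u)).
have y0E : aff_act (aff_inv g) y0 = t *: u.
  rewrite /y0 (nbhs_singleton gE) /aff_act /= mulmxDr !mulmxA mulVmx //.
  by rewrite !mul1mx addrK.
rewrite -/y0 in fE; clearbody y0.
have -> : (coord c \o (fun s => torus_proj (s *: u)))^`()%classic t = g.1 *m u.
  have cu : (fun s : R => s *: u) @ t --> t *: u by exact: scalel_continuous.
  have sE : \forall s \near t, (fun s => s *: (g.1 *m u) + g.2) s =
      (coord c \o (fun s => torus_proj (s *: u))) s.
    have nE : \forall s \near t,
        coord c (torus_proj (s *: u)) = aff_act g (s *: u).
      exact: cu _ gE.
    by apply: filterS nE => s /= ->; rewrite /aff_act scalemxAr.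
  have dl : is_diff t (fun s => s *: (g.1 *m u) + g.2)
      (fun s => s *: (g.1 *m u)).
    apply: is_diff_eq (is_diffD (is_diff_scalel _ _) (is_diff_cst _ _)) _.
    by rewrite addr0.
  have dE := near_eq_is_diff sE (@ex_diff _ _ _ _ _ _ _ dl).
  rewrite derive1E deriveE; last exact: (@ex_diff _ _ _ _ _ _ _ dE).
  by rewrite (@diff_val _ _ _ _ _ _ _ dE) (@diff_val _ _ _ _ _ _ _ dl) scale1r.
rewrite jac_mulmx.
have dA := is_diff_mulmx AR (aff_act (aff_inv g) y0).
have dg := is_diff_aff_act (aff_inv g) y0.
have dW := differentiableP (lift_C1 ac' c't).1.
rewrite -y0E in dW.
have dall := is_diff_comp (is_diff_comp dg dA) dW.
have nE : \forall y \near y0,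
    ((coord c' \o phi) \o (mulmx AR \o aff_act (aff_inv g))) y =
    (coord c' \o (f \o torus_map A) \o param c) y.
  by apply: filterS fE => y /= ->.
have dE := near_eq_is_diff nE (@ex_diff _ _ _ _ _ _ _ dall).
have E1 := congr1 (fun h => h (g.1 *m u)) (@diff_val _ _ _ _ _ _ _ dE).
have E2 := congr1 (fun h => h (g.1 *m u)) (@diff_val _ _ _ _ _ _ _ dall).
have vE : AR *m ((aff_inv g).1 *m (g.1 *m u)) = AR *m u.
  congr (AR *m _); rewrite mulmxA (mulVmx gu); exact: mul1mx.
have aE : AR *m (aff_act (aff_inv g) y0) = AR *m (t *: u) by rewrite y0E.
apply: (eq_trans E1); apply: (eq_trans E2); rewrite -vE -aE.
by [].
Qed.

(** The lifted loop is the segment t |-> t A e_i.  Whatever charts are chosen to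
evaluate the integrand, it is the derivative of F along this segment. *)
Lemma path_integral_pullback (i : 'I_2) :
  path_integral (pullback (f \o torus_map A) th) (@alpha R i) =
  F (AR *m delta_mx i 0) - F 0.
Proof.
set u : plane R := delta_mx i 0.
pose v := AR *m u.
have integrandE t : get [set r : R | exists c : chart R (T2 R),
    [/\ atlas c, dom c (@alpha R i t) &
      r = (pullback (f \o torus_map A) th c (@alpha R i t) *m
           derive1 (coord c \o @alpha R i) t) 0 0]] = 'd F (t *: v) v.
  have ex : exists r : R, exists c : chart R (T2 R),
    [/\ atlas c, dom c (@alpha R i t) &
      r = (pullback (f \o torus_map A) th c (@alpha R i t) *m
           derive1 (coord c \o @alpha R i) t) 0 0].
    eexists; exists (torus_chart (t *: u)); split; last reflexivity.
      exact: torus_chart_atlas.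
    by exists (t *: u) => //; apply: ballxx; rewrite divr_gt0.
  have [c [ac ct ->]] := getPex ex.
  have fE : (f \o torus_map A) (@alpha R i t) = phi (AR *m (t *: u)).
    by rewrite /alpha /= torus_mapE.
  have ex' : exists r : 'rV[R]_2, exists c' : chart R M,
    [/\ atlas c', dom c' ((f \o torus_map A) (@alpha R i t)) &
        r = th c' ((f \o torus_map A) (@alpha R i t)) *m
          jac (coord c' \o (f \o torus_map A) \o param c)
            (coord c (@alpha R i t))].
    have [c' ac' c't] := M_charts ((f \o torus_map A) (@alpha R i t)).
    by eexists; exists c'; split; last reflexivity.
  rewrite /pullback; have [c' [ac' c't ->]] := getPex ex'.
  rewrite fE in c't; rewrite fE -mulmxA pullback_velocity // /v scalemxAr.
  by rewrite (@diff_val _ _ _ _ _ _ _ (primitive_is_diff ac' c't)).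
have dF (t : R) : is_derive t (1 : R) (fun t => F (t *: v)) ('d F (t *: v) v).
  have dl := is_diff_scalel t v.
  have dFv := differentiableP (primitive_differentiable (t *: v)).
  have dFt := is_diff_comp dl dFv.
  split; first exact/diff_derivable/(@ex_diff _ _ _ _ _ _ _ dFt).
  rewrite deriveE; last exact: (@ex_diff _ _ _ _ _ _ _ dFt).
  by rewrite (@diff_val _ _ _ _ _ _ _ dFt) /= scale1r.
have cdF : continuous (fun t : R => 'd F (t *: v) v : R).
  move=> t; apply: (@continuous_comp _ _ _ (fun t : R => t *: v)
    (fun a => 'd F a v : R)).
    exact: scalel_continuous.
  exact: primitive_diff_continuous.
rewrite /path_integral; under eq_Rintegral do rewrite integrandE.
rewrite /Rintegral (@continuous_FTC2 R _ (fun t => F (t *: v)) 0 1) //=.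
- by rewrite scale1r scale0r.
- exact: continuous_subspaceT.
- have cF (t : R) : {for t, continuous (fun t : R => F (t *: v))}.
    by apply: differentiable_continuous; apply/derivable1_diffP; case: (dF t).
  split.
  + by move=> t _; case: (dF t).
  + exact/cvg_at_right_filter/cF.
  + exact/cvg_at_left_filter/cF.
- by move=> t _; rewrite derive1E (@derive_val _ _ _ _ _ _ _ (dF t)).
Qed.

End Curve.

End Potential.

(** * The action of an integer matrix on the periods *)

Lemma additive_int_colE (R : realType) (p : 'cV[int]_2 -> R) (z : 'cV[int]_2) :
  {morph p : x y / x + y} -> p z = \sum_j (z j 0)%:~R * p (delta_mx j 0).
Proof.
move=> pD.
have p_additive : zmod_morphism p.
  by move=> x y; rewrite -[X in p X - p y](subrK y) [X in X - p y]pD addrK.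
pose pM := GRing.isZmodMorphism.Build _ _ _ p_additive.
pose q : {additive 'cV[int]_2 -> R} := HB.pack p pM.
rewrite -[p]/(q : _ -> _) {1}[z]matrix_sum_delta raddf_sum.
apply: eq_bigr => j _; rewrite big_ord1 mulrzl.
by rewrite -[X in q (X *: _)]intz scaler_int raddfMz.
Qed.

Theorem lemma5p3 (R : realType) (M : atlasSpace R) (f : T2 R -> M)
    (A : 'M[int]_2)
    (fM : marked_complete_affine_torus f) (hA : \det A = 1) :
  period (f \o torus_map (R := R) A) = (map_mx intr A)^T *m period f.
Proof.
case: fM => -[_ _ M_charts M_compat _] _ [f_smooth _ _].
rewrite /period; case: asboolP => _; first by rewrite mulmx0.
have par := @eta_M_parallel R M; have tens := @eta_M_tensorial R M.
have [F F_prim] := plane_primitive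
  (local_potential_ex f (@eta_M R M) M_charts) (local_potential_open f_smooth)
  (local_potential_uniq M_compat f_smooth par tens).
have periodE B i := path_integral_pullback M_charts f_smooth par F_prim B i.
pose p (z : 'cV[int]_2) := F (int_vec R z) - F 0.
have pD : {morph p : x y / x + y}.
  move=> x y; rewrite /p map_mxD.
  by rewrite -(primitive_translate M_charts F_prim (int_vec R x) y); ring.
have deltaE (j : 'I_2) : int_vec R (delta_mx j 0) = delta_mx j 0.
  by rewrite map_delta_mx.
have idE (j : 'I_2) :
    path_integral (pullback f (@eta_M R M)) (@alpha R j) = p (delta_mx j 0).
  (* The loop itself is the case of the identity matrix. *)
  have f1 : f \o torus_map 1%:M = f.
    apply/funext => x; have [a ->] := torus_proj_surj x.
    by rewrite /= torus_mapE map_mx1 mul1mx.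
  by have := periodE 1%:M j; rewrite f1 map_mx1 mul1mx /p deltaE.
apply/colP => i; rewrite [LHS]mxE [RHS]mxE; apply: (eq_trans (periodE A i)).
have -> : F (map_mx intr A *m delta_mx i 0) - F 0 = p (A *m delta_mx i 0).
  by rewrite /p map_mxM deltaE.
rewrite (additive_int_colE _ pD); apply: eq_bigr => j _.
by rewrite [X in _ = _ * X]mxE idE -colE !mxE.
Qed.
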